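(* The following unimodular simply connected Lie groups do not admit lattices: - $S_3^{a,b,c,d}$ with $a,c\in\mathbb{R}$, $a+c=-\frac34$, $0<b<d$; - $S_4^{a,b,c}$ with $a\le c$, $a+c=-\frac34$, $b>0$; - $S_7^{a,c,d}$ with $a,c\in\mathbb{R}$, $a+c=-\frac34$, $d>0$; - $S_8^{-\frac74,d}$ with $d>0$; - $S_{11}^{a,c}$ with $a\le c$, $a+c=-\frac34$; - $S_{12}^{-\frac74}$; - $S_{14}^{-\frac38,b}$ with $b>0$; - $S_{17}^{-\frac38}$.
   Context: A lattice in a simply connected solvable Lie group $G$ is a discrete subgroup $\Gamma$ with $\Gamma\backslash G$ compact. For $A\in\mathfrak{gl}(11,\mathbb{R})$, the simply connected Lie group with Lie algebra $\mathbb{R}e_0\ltimes_A\mathbb{R}^{11}$ ($\mathbb{R}^{11}$ an abelian ideal, $[e_0,v]=Av$) is $\mathbb{R}\times\mathbb{R}^{11}$ with product $(t,v)(s,w)=(t+s,v+e^{tA}w)$. Put $$K(a,b)=\begin{bmatrix}a&-b&0&0\\ b&a&0&0\\ 0&0&a&b\\ 0&0&-b&a\end{bmatrix},\qquad U=\begin{bmatrix}0&0&0\\ 1&0&0\\ 0&1&0\\ 0&0&1\end{bmatrix},$$ and let $\oplus$ denote block diagonal sum. The groups correspond to the following matrices $A$: $S_3^{a,b,c,d}$: $I_3\oplus K(a,b)\oplus K(c,d)$; $S_4^{a,b,c}$: $I_3\oplus K(a,b)\oplus K(c,b)$; $S_7^{a,c,d}$: $I_3\oplus aI_4\oplus K(c,d)$;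 $S_8^{c,d}$: $\begin{bmatrix}I_3&0\\ U&I_4\end{bmatrix}\oplus K(c,d)$; $S_{11}^{a,c}$: $I_3\oplus aI_4\oplus cI_4$; $S_{12}^{c}$: $\begin{bmatrix}I_3&0\\ U&I_4\end{bmatrix}\oplus cI_4$; $S_{14}^{a,b}$: $I_3\oplus\begin{bmatrix}K(a,b)&0\\ I_4&K(a,b)\end{bmatrix}$; $S_{17}^{a}$: $I_3\oplus\begin{bmatrix}aI_4&0\\ I_4&aI_4\end{bmatrix}$. *)

(* Defs.v *)
From HB Require Import structures.
From mathcomp Require Import all_boot all_order all_algebra generic_quotient.
From mathcomp Require Import all_classical all_reals all_analysis.

Set Implicit Arguments.
Unset Strict Implicit.
Unset Printing Implicit Defensive.

Import Order.TTheory GRing.Theory Num.Theory.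
Import numFieldNormedType.Exports.
Local Open Scope classical_set_scope.
Local Open Scope quotient_scope.
Local Open Scope ring_scope.

Definition expmx (R : realType) (n : nat) (A : 'M[R]_n) : 'M[R]_n :=
  lim (series (fun k => k`!%:R^-1 *: A ^+ k) @ \oo).

(* The simply connected Lie group with Lie algebra R e_0 |x_A R^n: the product
   topological space R x R^n, with the semidirect product operations. *)
Definition semidirect (R : realType) (n : nat) (A : 'M[R]_n) : Type :=
  (R * 'cV[R]_n)%type.

Section Semidirect.
Variables (R : realType) (n : nat) (A : 'M[R]_n).
Local Notation G := (semidirect A).

HB.instance Definition _ := Topological.copy G (R * 'cV[R]_n)%type.

Definition sd_mul (g h : G) : G := (g.1 + h.1, g.2 + expmx (g.1 *: A) *m h.2).
Definition sd_one : G := (0, 0).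
Definition sd_inv (g : G) : G := (- g.1, - (expmx (- g.1 *: A) *m g.2)).

(* Only the operations are registered: no definition below needs the group
   laws. *)
HB.instance Definition _ := hasMul.Build G sd_mul.
HB.instance Definition _ := hasOne.Build G sd_one.
HB.instance Definition _ := hasInv.Build G sd_inv.

End Semidirect.

Section Lattice.
Variables (R : realType) (n : nat) (A : 'M[R]_n).
Local Notation G := (semidirect A).

(* The coset Gamma g. *)
Definition coset_at (Gamma : set G) (g : G) : set G :=
  [set (x * g)%g | x in Gamma].

Definition coset_rel (Gamma : set G) : rel G :=
  fun g h => `[< coset_at Gamma g = coset_at Gamma h >].

Lemma coset_rel_refl Gamma : reflexive (coset_rel Gamma).
Proof. by move=> g; apply/asboolP. Qed.

Lemma coset_rel_sym Gamma : symmetric (coset_rel Gamma).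
Proof. by move=> g h; apply/asboolP/asboolP => ->. Qed.

Lemma coset_rel_trans Gamma : transitive (coset_rel Gamma).
Proof. by move=> h g k /asboolP gh /asboolP hk; apply/asboolP; rewrite gh. Qed.

Canonical coset_equiv (Gamma : set G) : equiv_rel G :=
  EquivRel (coset_rel Gamma) (@coset_rel_refl Gamma) (@coset_rel_sym Gamma)
    (@coset_rel_trans Gamma).

(* The space Gamma\G, with the quotient topology. *)
Definition coset_space (Gamma : set G) : topologicalType :=
  quotient_topology {eq_quot coset_equiv Gamma}.

Definition is_subgroup (Gamma : set G) : Prop :=
  [/\ Gamma 1%g,
      forall x y, Gamma x -> Gamma y -> Gamma (x * y)%g &
      forall x, Gamma x -> Gamma (x^-1)%g].

Definition is_lattice (Gamma : set G) : Prop :=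
  [/\ is_subgroup Gamma,
      Gamma `<=` isolated Gamma &
      compact [set: coset_space Gamma]].

Definition admits_lattice : Prop := exists Gamma : set G, is_lattice Gamma.

End Lattice.

Section Unimodular.
Variables (R : realType) (n : nat) (A : 'M[R]_n).

(* The Lie algebra R e_0 |x_A R^n, where (s, v) stands for s e_0 + v. *)
Definition sd_bracket (x y : R * 'cV[R]_n) : R * 'cV[R]_n :=
  (0, x.1 *: (A *m y.2) - y.1 *: (A *m x.2)).

Definition trace_ad (x : R * 'cV[R]_n) : R :=
  (sd_bracket x (1, 0)).1
  + \sum_(i < n) (sd_bracket x (0, delta_mx i 0)).2 i 0.

Definition unimodular : Prop := forall x, trace_ad x = 0.

End Unimodular.

Section Matrices.
Variable R : realType.

Definition mx_of_rows (m n : nat) (rows : seq (seq R)) : 'M[R]_(m, n) :=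
  \matrix_(i < m, j < n) nth 0 (nth [::] rows i) j.

Definition Kmx (a b : R) : 'M[R]_4 := mx_of_rows 4 4
  [:: [:: a; - b; 0; 0];
      [:: b; a; 0; 0];
      [:: 0; 0; a; b];
      [:: 0; 0; - b; a]].

Definition Umx : 'M[R]_(4, 3) := mx_of_rows 4 3
  [:: [:: 0; 0; 0];
      [:: 1; 0; 0];
      [:: 0; 1; 0];
      [:: 0; 0; 1]].

Definition dsum (m n : nat) (A : 'M[R]_m) (B : 'M[R]_n) : 'M[R]_(m + n) :=
  block_mx A 0 0 B.

Definition IUI : 'M[R]_(3 + 4) := block_mx 1%:M 0 Umx 1%:M.

Definition S3 (a b c d : R) : 'M[R]_11 :=
  dsum (1%:M : 'M[R]_3) (dsum (Kmx a b) (Kmx c d)).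
Definition S4 (a b c : R) : 'M[R]_11 :=
  dsum (1%:M : 'M[R]_3) (dsum (Kmx a b) (Kmx c b)).
Definition S7 (a c d : R) : 'M[R]_11 :=
  dsum (1%:M : 'M[R]_3) (dsum (a%:M : 'M[R]_4) (Kmx c d)).
Definition S8 (c d : R) : 'M[R]_11 := dsum IUI (Kmx c d).
Definition S11 (a c : R) : 'M[R]_11 :=
  dsum (1%:M : 'M[R]_3) (dsum (a%:M : 'M[R]_4) (c%:M : 'M[R]_4)).
Definition S12 (c : R) : 'M[R]_11 := dsum IUI (c%:M : 'M[R]_4).
Definition S14 (a b : R) : 'M[R]_11 :=
  dsum (1%:M : 'M[R]_3) (block_mx (Kmx a b) 0 1%:M (Kmx a b)).
Definition S17 (a : R) : 'M[R]_11 :=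
  dsum (1%:M : 'M[R]_3) (block_mx (a%:M : 'M[R]_4) 0 1%:M (a%:M : 'M[R]_4)).

End Matrices.

(* Main.v *)
From HB Require Import structures.
Require Import Defs.
From mathcomp Require Import all_boot all_order all_algebra generic_quotient.
From mathcomp Require Import all_classical all_reals all_analysis.
From mathcomp Require Import complex.
From mathcomp Require polyorder.
From mathcomp Require Import ring lra zify.

(** If R |x_A R^n has a lattice Gamma and A has a left eigenvector of eigenvalue
    1, then the times of Gamma form a nontrivial discrete subgroup of R, so
    L := Gamma /\ R^n is a cocompact discrete subgroup of R^n, preserved by
    B := exp(t A) for some t <> 0. In a basis taken in L, B is a rational matrix.
    For all the groups considered, the blocks of exp(t A) other than one diagonal
    entry e^t come in pairs with the same characteristic polynomial, so
    char_poly B = (X - e^t) g^2. As conjugate roots have the same multiplicity,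
    e^t is rational, and it has a rational eigenform mu. The values
    mu (B^k w) = e^(kt) mu w, w in L, have a common denominator for all k in Z,
    which is absurd because e^(kt) tends to 0 in one direction. *)


Set Implicit Arguments.
Unset Strict Implicit.
Unset Printing Implicit Defensive.
Import Order.TTheory GRing.Theory Num.Theory.
Import numFieldNormedType.Exports.
Local Open Scope classical_set_scope.
Local Open Scope quotient_scope.
Local Open Scope ring_scope.

(** * Matrix exponential *)

Section MatrixNorm.
Variable R : realType.

Lemma ler_entry_mx_norm m n (M : 'M[R]_(m, n)) i j : `|M i j| <= `|M|.
Proof. by rewrite [leRHS]/Num.Def.normr/= mx_normrE; exact: (le_bigmax _ _ (i, j)). Qed.

Lemma mx_norm_le m n (M : 'M[R]_(m, n)) c :
  0 <= c -> (forall i j, `|M i j| <= c) -> `|M| <= c.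
Proof.
by move=> c0 Mc; rewrite [leLHS]/Num.Def.normr/= mx_normrE;
  apply: bigmax_le => // -[i j] _ /=.
Qed.

(** The norm is the largest absolute value of an entry, which is not submultiplicative; hence the
    factor [n]. *)
Lemma mx_norm_mulmx m n p (M : 'M[R]_(m, n)) (N : 'M[R]_(n, p)) :
  `|M *m N| <= n%:R * `|M| * `|N|.
Proof.
apply: mx_norm_le => [|i j]; first by rewrite !mulr_ge0.
rewrite mxE (le_trans (ler_norm_sum _ _ _))//.
rewrite -mulrA -[n in n%:R]card_ord mulr_natl -sumr_const; apply: ler_sum => k _.
by rewrite normrM ler_pM// ler_entry_mx_norm.
Qed.

Lemma cvg_mx_entries m n (F : nat -> 'M[R]_(m, n)) (L : 'M[R]_(m, n)) :
  (forall i j, (F k i j @[k --> \oo] --> L i j)) -> F @ \oo --> L.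
Proof.
move=> FL; apply/cvgrPdist_le => e e0; near=> k.
apply: mx_norm_le => [|i j]; first exact: ltW.
move: i j; near: k; apply: filter_forall => i; apply: filter_forall => j.
by have /cvgrPdist_le/(_ _ e0) := FL i j; apply: filterS => k; rewrite !mxE.
Unshelve. all: by end_near. Qed.

End MatrixNorm.

Section MatrixExponential.
Variables (R : realType).

(** Coefficients in [t] of one entry of [exp (t A)], so that the theory of scalar power series
    applies entry by entry. *)
Definition expmx_coef n (A : 'M[R]_n) (i j : 'I_n) (k : nat) : R :=
  k`!%:R^-1 * (A ^+ k) i j.

Lemma ler_norm_mxX n (A : 'M[R]_n) i j k :
  `|(A ^+ k) i j| <= (n%:R * `|A|) ^+ k.
Proof.
elim: k i j => [|k IH] i j.
  by rewrite !expr0 mxE; case: (i == j); rewrite ?normr1// normr0.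
rewrite exprS mxE (le_trans (ler_norm_sum _ _ _))//.
rewrite exprS -mulrA -[n in n%:R * _]card_ord mulr_natl -sumr_const.
apply: ler_sum => l _.
by rewrite normrM ler_pM// ler_entry_mx_norm.
Qed.

(** Domination by the exponential series at [n |A| |x|]. *)
Lemma is_cvg_expmx_coef n (A : 'M[R]_n) i j x :
  cvgn (pseries (expmx_coef A i j) x).
Proof.
apply: normed_cvg.
apply: series_le_cvg (is_cvg_series_exp_coeff (n%:R * `|A| * `|x|)) => [k|k|k] //=.
  by rewrite /exp_coeff/= divr_ge0// exprn_ge0// !mulr_ge0.
rewrite /exp_coeff/= [leRHS]mulrC /expmx_coef -[X in `|X|]mulrA normrM normfV normr_nat.
rewrite ler_wpM2l ?invr_ge0// normrM normrX exprMn ler_wpM2r ?exprn_ge0//.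
exact: ler_norm_mxX.
Qed.

Lemma scalemxX n (A : 'M[R]_n) t k : (t *: A) ^+ k = t ^+ k *: A ^+ k.
Proof.
elim: k => [|k IH]; first by rewrite !expr0 scale1r.
by rewrite !exprS IH -mulmxE -scalemxAl -scalemxAr scalerA.
Qed.

Lemma expmxZE n (A : 'M[R]_n) t i j :
  expmx (t *: A) i j = limn (pseries (expmx_coef A i j) t).
Proof.
pose L := \matrix_(i, j) limn (pseries (expmx_coef A i j) t).
suff -> : expmx (t *: A) = L by rewrite mxE.
apply/cvg_lim => //; apply: cvg_mx_entries => a b; rewrite mxE.
have -> : (fun k => series (fun k => k`!%:R^-1 *: (t *: A) ^+ k) k a b) =
   pseries (expmx_coef A a b) t.
  apply/funext => k; rewrite /pseries /series /= summxE; apply: eq_bigr => l _.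
  rewrite /expmx_coef scalemxX !mxE; ring.
exact: is_cvg_expmx_coef.
Qed.

Lemma expmxE n (A : 'M[R]_n) i j :
  expmx A i j = limn (series (expmx_coef A i j)).
Proof.
rewrite -[A in LHS]scale1r expmxZE /pseries; congr (limn (series _)).
by apply/funext => k; rewrite /= expr1n mulr1.
Qed.

Lemma expmx0 n : expmx (0 : 'M[R]_n) = 1%:M.
Proof.
apply/matrixP => i j; rewrite expmxE; apply: lim_near_cst => //; near=> m.
rewrite -[m]prednK; last by near: m.
rewrite /series /= big_nat_recl// big1 ?addr0 => [|k _].
  by rewrite /expmx_coef expr0 fact0 invr1 mul1r.
by rewrite /expmx_coef expr0n mxE mulr0.
Unshelve. all: by end_near. Qed.

Lemma pseries_diffs_expmx n (A : 'M[R]_n) i j :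
  pseries_diffs (expmx_coef A i j) =
  fun k => \sum_l A i l * expmx_coef A l j k.
Proof.
apply/funext => k; rewrite /pseries_diffs /expmx_coef.
rewrite factS natrM invfM mulrA mulrA mulfV ?pnatr_eq0// mul1r.
by rewrite exprS mxE mulr_sumr; apply: eq_bigr => l _; rewrite mulrCA.
Qed.

Lemma cvg_pseries_sum n (a : 'I_n -> R) (f : 'I_n -> nat -> R) x :
  (forall l, cvgn (pseries (f l) x)) ->
  pseries (fun k => \sum_l a l * f l k) x @ \oo -->
    \sum_l a l * limn (pseries (f l) x).
Proof.
move=> fc.
have -> : pseries (fun k => \sum_l a l * f l k) x =
          fun k => \sum_l a l * pseries (f l) x k.
  apply/funext => k; rewrite /pseries /series /=.
  under [RHS]eq_bigr do rewrite mulr_sumr.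
  rewrite exchange_big /=; apply: eq_bigr => m _.
  by rewrite mulr_suml; apply: eq_bigr => l _; rewrite mulrA.
apply: cvg_big; first exact: add_continuous.
by move=> l _; apply: cvgMl_tmp; exact: fc.
Qed.

Lemma is_derive_expmx n (A : 'M[R]_n) i j t :
  is_derive t (1 : R) (fun t => expmx (t *: A) i j)
    ((A *m expmx (t *: A)) i j).
Proof.
have -> : (fun t => expmx (t *: A) i j) =
          fun t => limn (pseries (expmx_coef A i j) t).
  by apply/funext => s; rewrite expmxZE.
have c1 i' x : cvgn (pseries (pseries_diffs (expmx_coef A i' j)) x).
  rewrite pseries_diffs_expmx; apply/cvg_ex; eexists; apply: cvg_pseries_sum.
  by move=> l; exact: is_cvg_expmx_coef.
have -> : (A *m expmx (t *: A)) i j =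
          limn (pseries (pseries_diffs (expmx_coef A i j)) t).
  apply/esym/cvg_lim => //; rewrite pseries_diffs_expmx mxE.
  under eq_bigr do rewrite expmxZE.
  by apply: cvg_pseries_sum => l; exact: is_cvg_expmx_coef.
(* Termwise differentiation asks that the series and its first two formal derivatives converge at a
   point of modulus above [|t|]; each derivative is a linear combination of entry series, which
   converge everywhere. *)
apply: (@pseries_snd_diffs _ _ (`|t| + 1)).
- exact: is_cvg_expmx_coef.
- exact: c1.
- rewrite pseries_diffs_expmx.
  have -> : pseries_diffs (fun k => \sum_l A i l * expmx_coef A l j k) =
     fun k => \sum_l A i l * pseries_diffs (expmx_coef A l j) k.
    apply/funext => k; rewrite /pseries_diffs mulr_sumr.
    by apply: eq_bigr => l _; rewrite mulrCA.
  by apply/cvg_ex; eexists; apply: cvg_pseries_sum => l; exact: c1.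
- by rewrite [ltRHS]ger0_norm ?addr_ge0// ltrDl.
Qed.

Lemma expmx_comm n (A : 'M[R]_n) t : A *m expmx (t *: A) = expmx (t *: A) *m A.
Proof.
apply/matrixP => i j; rewrite !mxE.
under eq_bigr do rewrite expmxZE.
under [RHS]eq_bigr do rewrite expmxZE mulrC.
have c l k := @is_cvg_expmx_coef n A l k t.
rewrite -(cvg_lim _ (cvg_pseries_sum (a := fun l => A i l) (fun l => c l j)))//.
rewrite -(cvg_lim _ (cvg_pseries_sum (a := fun l => A l j) (fun l => c i l)))//.
congr (limn (pseries _ t)); apply/funext => k; rewrite /expmx_coef.
have h : \sum_l A i l * (A ^+ k) l j = \sum_l (A ^+ k) i l * A l j.
  by have := congr1 (fun M : 'M[R]_n => M i j) (commrX k (commr_refl A)); rewrite !mxE.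
transitivity (k`!%:R^-1 * \sum_l A i l * (A ^+ k) l j).
  by rewrite mulr_sumr; apply: eq_bigr => l _; rewrite mulrCA.
by rewrite h mulr_sumr; apply: eq_bigr => l _; rewrite [RHS]mulrC mulrA.
Qed.

(** The product [exp ((c - u) A) exp (u A)] has derivative 0 in [u], so it is constant; with
    [c = s + t], compare [u = t] and [u = 0]. *)
Lemma expmxD n (A : 'M[R]_n) s t :
  expmx ((s + t) *: A) = expmx (s *: A) *m expmx (t *: A).
Proof.
suff h c x y : expmx ((c - x) *: A) *m expmx (x *: A) =
               expmx ((c - y) *: A) *m expmx (y *: A).
  by have := h (s + t) t 0; rewrite addrK subr0 scale0r expmx0 mulmx1.
apply/matrixP => i j.
pose f u : R := (expmx ((c - u) *: A) *m expmx (u *: A)) i j.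
rewrite -/(f x) -/(f y); apply: is_derive_0_is_cst => u.
have -> : f = \sum_l ((fun t => expmx ((c - t) *: A) i l) *
                      (fun t => expmx (t *: A) l j)).
  by apply/funext => v; rewrite /f mxE fct_sumE; apply: eq_bigr.
have d1 l : is_derive u (1 : R) (fun t => expmx ((c - t) *: A) i l)
    (- (A *m expmx ((c - u) *: A)) i l).
  have dg : is_derive u (1 : R) (fun t => c - t) (-1).
    have := is_deriveB (is_derive_cst c u (1 : R)) (is_derive_id u (1 : R)).
    by rewrite sub0r.
  have := @is_derive1_comp _ (fun t => expmx (t *: A) i l) (fun t => c - t) u _ _
    (is_derive_expmx A i l (c - u)) dg.
  by rewrite mulrN1.
have d2 l := is_derive_expmx A l j u.
apply: (@is_derive_eq _ _ _ _ _ _ _ _ (@is_derive_sum _ R R n _ u 1 _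
  (fun l => is_deriveM (d1 l) (d2 l)))).
rewrite /= big_split /= (expmx_comm A (c - u)).
rewrite [X in _ + X](_ : _ = - (expmx ((c - u) *: A) *m A *m expmx (u *: A)) i j).
  rewrite [X in X - _](_ : _ = (expmx ((c - u) *: A) *m (A *m expmx (u *: A))) i j).
    by rewrite mulmxA subrr.
  by rewrite [RHS]mxE; apply: eq_bigr.
by rewrite [in RHS]mxE -sumrN; apply: eq_bigr => l _; rewrite /GRing.scale/= mulrN mulrC.
Qed.

Lemma expmxKN n (A : 'M[R]_n) t : expmx (t *: A) *m expmx (- t *: A) = 1%:M.
Proof. by rewrite -expmxD addrN scale0r expmx0. Qed.

Lemma cvg_expmx0 n (A : 'M[R]_n) (e : R) : 0 < e ->
  exists2 d : R, 0 < d & forall t, `|t| < d -> `|expmx (t *: A) - 1%:M| <= e.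
Proof.
move=> e0; have dA : derivable (fun t : R => expmx (t *: A)) 0 1.
  by apply/derivable_mxP => i j; have [] := is_derive_expmx A i j 0.
have /derivable1_diffP/differentiable_continuous/cvgrPdist_le/(_ e e0) := dA.
move=> /nbhs_ballP[d /= d0 hd]; exists d => // t td.
have := hd t; rewrite /ball/= sub0r normrN scale0r expmx0 distrC; exact.
Qed.

Lemma eigen_expmx n (A : 'M[R]_n) (u : 'rV[R]_n) t :
  u *m A = u -> u *m expmx (t *: A) = expR t *: u.
Proof.
move=> uA; apply/matrixP => i j; rewrite !mxE.
under eq_bigr do rewrite expmxZE.
have c l := @is_cvg_expmx_coef n A l j t.
rewrite -(cvg_lim _ (cvg_pseries_sum (a := fun l => u i l) c))//.
rewrite /expR mulrC.
rewrite -(cvg_lim _ (cvgMl_tmp (a := u i j) (is_cvg_series_exp_coeff t)))//.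
congr (lim (_ @ \oo)); apply/funext => m.
rewrite /pseries/series /= mulr_sumr; apply: eq_bigr => k _.
have uAk : u *m (A ^+ k) = u.
  by elim: k => [|k IH]; [rewrite expr0 mulmx1|rewrite exprS mulmxA uA].
rewrite /exp_coeff /= /expmx_coef -[in RHS]uAk mxE !mulr_suml; apply: eq_bigr => l _.
ring.
Qed.

Lemma expmx_scalar n (a : R) : expmx (a%:M : 'M[R]_n) = (expR a)%:M.
Proof.
have -> : (a%:M : 'M[R]_n) = a *: 1%:M by rewrite scalemx1.
rewrite -[LHS]mul1mx; apply/row_matrixP => i; rewrite row_mul eigen_expmx ?mulmx1//.
by rewrite row1 -scalemx1 linearZ /= row1.
Qed.

Lemma expmx_tr n (A : 'M[R]_n) : expmx A^T = (expmx A)^T.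
Proof.
apply/matrixP => i j; rewrite mxE !expmxE; congr (limn (series _)).
apply/funext => k; rewrite /expmx_coef; congr (_ * _).
suff -> : A^T ^+ k = (A ^+ k)^T by rewrite mxE.
by elim: k => [|k IH]; rewrite ?trmx1// exprS exprSr IH -[LHS]trmx_mul.
Qed.

Lemma lblock_mxX m n (A : 'M[R]_m) (C : 'M[R]_(n, m)) (D : 'M[R]_n) k :
  exists C', block_mx A 0 C D ^+ k = block_mx (A ^+ k) 0 C' (D ^+ k).
Proof.
elim: k => [|k [C' IH]]; first by exists 0; rewrite !expr0 -scalar_mx_block.
eexists; rewrite exprS IH [LHS]mulmx_block !(mul0mx, mulmx0, addr0, add0r) !exprS.
reflexivity.
Qed.

(** Powers of a block triangular matrix act separately on the diagonal blocks. The block [C'] stays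
    unspecified because characteristic polynomials do not see it. *)
Lemma expmx_lblock m n (A : 'M[R]_m) (C : 'M[R]_(n, m)) (D : 'M[R]_n) :
  exists C', expmx (block_mx A 0 C D) = block_mx (expmx A) 0 C' (expmx D).
Proof.
set E := expmx _; exists (dlsubmx E); rewrite -[E in LHS]submxK.
congr block_mx; apply/matrixP => i j; rewrite 2!mxE /E expmxE.
- rewrite expmxE; congr (limn (series _)); apply/funext => k.
  rewrite /expmx_coef; have [C' ->] := lblock_mxX A C D k.
  by rewrite block_mxEul.
- rewrite (_ : expmx_coef _ _ _ = fun=> 0).
    apply: lim_near_cst => //; apply: nearW => k.
    by rewrite /series /= big1 // mxE.
  apply/funext => k.
  rewrite /expmx_coef; have [C' ->] := lblock_mxX A C D k.
  by rewrite block_mxEur mxE mulr0.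
- rewrite expmxE; congr (limn (series _)); apply/funext => k.
  rewrite /expmx_coef; have [C' ->] := lblock_mxX A C D k.
  by rewrite block_mxEdr.
Qed.

End MatrixExponential.

(** * Roots of odd multiplicity *)

Section OddRoot.

Lemma double_root_deriv (F : fieldType) (p : {poly F}) x :
  ('X - x%:P) ^+ 2 %| p -> root p^`() x.
Proof.
case/dvdpP => q ->.
rewrite expr2 mulrA /root derivM hornerD !hornerM hornerXsubC subrr.
by rewrite !(mulr0, mul0r) addr0.
Qed.

Lemma mup_eq1 (F : fieldType) (p : {poly F}) x :
  root p x -> ~~ root p^`() x -> mup x p = 1%N.
Proof.
move=> px p'x; have p0 : p != 0.
  by apply: contraNneq p'x => ->; rewrite deriv0 root0.
apply/eqP; rewrite eqn_leq mup_leq// mup_geq// expr1 dvdp_XsubCl px andbT.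
by apply: contra p'x; exact: double_root_deriv.
Qed.

Variables (F : numFieldType) (alpha : F).

(** The minimal polynomial of [alpha] over the rationals, up to a nonzero scalar. *)
Definition least_rat_annihilator (p : {poly rat}) :=
  [/\ p != 0, root (map_poly ratr p) alpha &
    forall r : {poly rat}, r != 0 -> root (map_poly ratr r) alpha ->
      (size p <= size r)%N].

Lemma least_rat_annihilatorP (f : {poly rat}) :
  f != 0 -> root (map_poly ratr f) alpha -> exists p, least_rat_annihilator p.
Proof.
move=> f0 fa; pose P n := `[< exists r : {poly rat},
  [/\ r != 0, root (map_poly ratr r) alpha & size r = n] >].
have Pex : exists n, P n by exists (size f); apply/asboolP; exists f.
have [n /asboolP[p [p0 pa pn]] nmin] := ex_minnP Pex.
by exists p; split=> // r r0 ra; rewrite pn; apply: nmin; apply/asboolP; exists r.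
Qed.

Variable p : {poly rat}.
Hypothesis p_least : least_rat_annihilator p.

Let p0 : p != 0. Proof. by case: p_least. Qed.
Let pa : root (map_poly ratr p) alpha. Proof. by case: p_least. Qed.

Lemma least_rat_annihilator_gt1 : (1 < size p)%N.
Proof.
move: pa; rewrite ltnNge; apply: contraL => /size1_polyC pC.
by rewrite pC map_polyC rootC fmorph_eq0 -polyC_eq0 -pC.
Qed.

(** Write [p = e d] with [d] the gcd. Since [d] divides [r], it does not vanish at [alpha], so [e]
    does, and minimality of [p] makes [d] constant. *)
Lemma least_rat_annihilator_coprime (r : {poly rat}) :
  ~~ root (map_poly ratr r) alpha -> coprimep p r.
Proof.
move=> ra; rewrite /coprimep.
have /dvdpP[e pe] := dvdp_gcdl p r; set d := gcdp p r in pe *.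
have e0 : e != 0 by apply: contraNneq p0 => e0; rewrite pe e0 mul0r.
have d0 : d != 0 by apply: contraNneq p0 => d0; rewrite pe d0 mulr0.
have : root (map_poly ratr p) alpha by [].
rewrite pe rmorphM rootM => /orP[ea|da]; last first.
  have /dvdpP[c rc] := dvdp_gcdr p r.
  by move: ra; rewrite rc rmorphM rootM da orbT.
case: p_least => _ _ /(_ e e0 ea); rewrite [in X in (X <= _)%N]pe size_mul//.
rewrite -[in X in (_ <= X)%N](addn0 (size e)).
move: d0; rewrite -size_poly_gt0; case: (size d) => // n _.
by rewrite addnS /= leq_add2l leqn0 => /eqP ->.
Qed.

(** Divide by [p] as long as [alpha] is a root: the remainder vanishes at [alpha] and is smaller
    than [p], so it is 0. *)
Lemma least_rat_annihilator_factor (f : {poly rat}) : f != 0 ->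
  exists k r, f = p ^+ k * r /\ coprimep p r.
Proof.
have [n] := ubnP (size f); elim: n f => // n IH f fn f0.
have [fa|fa] := boolP (root (map_poly ratr f) alpha); last first.
  by exists 0%N, f; rewrite expr0 mul1r; split=> //; exact: least_rat_annihilator_coprime.
have /dvdpP[g fg] : p %| f.
  rewrite /dvdp -[_ == 0]negbK; apply/negP => m0.
  case: p_least => _ _ /(_ _ m0); rewrite leqNgt ltn_modp p0 => /(_ _)/negP; apply => //.
  move: fa; rewrite {1}(divp_eq f p) rmorphD rmorphM /= /root !hornerE.
  by move: pa => /rootP ->; rewrite mulr0 add0r.
have g0 : g != 0 by apply: contraNneq f0 => g0; rewrite fg g0 mul0r.
have [|k [r [gE cr]]] := IH g _ g0.
  move: fn least_rat_annihilator_gt1; rewrite fg size_mul //.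
  case: (size p) => [|[|m]]// + _; rewrite addnS /= ltnS => /(leq_trans _); apply.
  by rewrite addnS ltnS leq_addr.
by exists k.+1, r; rewrite fg gE exprS mulrC mulrA.
Qed.

End OddRoot.

Lemma ratr_horner_coprime (F : numFieldType) (p r : {poly rat}) (z : F) :
  coprimep p r -> root (map_poly ratr p) z -> ~~ root (map_poly ratr r) z.
Proof.
by rewrite -(coprimep_map (@ratr F)) => /coprimep_root h /h.
Qed.

(* Conjugate roots have the same multiplicity, so a root which is the only one
   of odd multiplicity has no other conjugate. *)
Lemma odd_root_rational (R : rcfType) (f : {poly rat}) (g : {poly R}) alpha :
  f != 0 -> map_poly ratr f = ('X - alpha%:P) * g ^+ 2 ->
  exists q : rat, alpha = ratr q.
Proof.
(* The conjugates of [alpha] may be non-real, so the multiplicities are compared over [R[i]]. *)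
move=> f0 fE; pose c := real_complex R; pose C := R[i].
have fC : map_poly ratr f = ('X - (c alpha)%:P) * map_poly c g ^+ 2 :> {poly C}.
  have := congr1 (map_poly c) fE.
  rewrite rmorphM rmorphXn /= map_polyXsubC => <-; rewrite -map_poly_comp.
  by apply: eq_map_poly => q /=; rewrite fmorph_rat.
have fC0 : map_poly ratr f != 0 :> {poly C} by rewrite map_poly_eq0.
have g0 : map_poly c g != 0.
  by apply: contraNneq fC0 => g0; rewrite fC g0 expr0n mulr0.
have fa : root (map_poly ratr f) (c alpha) by rewrite fC rootM root_XsubC eqxx.
have [p pmin] := least_rat_annihilatorP f0 fa.
have [p0 pa pleast] := pmin.
have [k [r [fpr cpr]]] := least_rat_annihilator_factor pmin f0.
have p_gt1 := least_rat_annihilator_gt1 pmin.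
(* The derivative of [p] is nonzero and smaller than [p], so it cannot vanish at [alpha]: [p] is
   separable. *)
have cpp' : coprimep p p^`().
  apply: (least_rat_annihilator_coprime pmin); apply/negP => p'a.
  have p'0 : p^`() != 0.
    by rewrite -size_poly_eq0 polyorder.size_deriv -lt0n -subn1 subn_gt0.
  by have := pleast _ p'0 p'a; rewrite leqNgt lt_size_deriv.
pose P : {poly C} := map_poly ratr p.
have P1 z : root P z -> mup z P = 1%N.
  by move=> pz; rewrite mup_eq1// deriv_map (ratr_horner_coprime cpp').
(* The multiplicity of [z] in [f], read once from [f = p ^+ k * r] and once from the factorisation
   with the square; it is odd only at [alpha]. *)
have k_mup z : root P z -> k = ((z == c alpha) + (mup z (map_poly c g)).*2)%N.
  move=> pz; transitivity (mup z (map_poly ratr f)).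
    rewrite fpr rmorphM rmorphXn /= mupMl ?(ratr_horner_coprime cpr)//.
    elim: k {fpr} => [|k IH]; first by rewrite expr0 mupNroot// root1.
    by rewrite exprS mupM ?expf_neq0 ?map_poly_eq0// -/P P1// -IH.
  rewrite fC mupM ?polyXsubC_eq0 ?expf_neq0// expr2 mupM// addnn.
  by rewrite -[_ - _]expr1 mup_XsubCX eq_sym; case: eqP.
have ukey z : root P z -> z = c alpha.
  have k_odd : odd k by rewrite (k_mup _ pa) eqxx oddD odd_double.
  move=> pz; apply/eqP; apply: contraLR k_odd => /negbTE za.
  by rewrite (k_mup _ pz) za add0n odd_double.
have /dvdpP[Q PQ] : 'X - (c alpha)%:P %| P by rewrite dvdp_XsubCl.
(* A root of [Q] would be a root of [P], hence [alpha] again, which would then be a double root of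
   [P]. *)
have Q1 : size Q == 1%N.
  apply/negPn/negP => /closed_rootP[z Qz].
  have za : z = c alpha by apply: ukey; rewrite PQ rootM Qz.
  have := P1 _ pa; apply/eqP; rewrite gtn_eqF// mup_geq ?map_poly_eq0//.
  by rewrite expr2 PQ dvdp_mul2r ?polyXsubC_eq0// dvdp_XsubCl -za.
have sp : size p = 2%N.
  rewrite -(size_map_poly (@ratr C)) -/P PQ size_Mmonic ?monicXsubC//.
    by rewrite size_XsubC (eqP Q1).
  by rewrite -size_poly_eq0 (eqP Q1).
have [q pq] := poly2_root sp; exists q.
have : root P (ratr q) by rewrite /P fmorph_root.
by move/ukey; rewrite -(fmorph_rat c) => /complexI.
Qed.

Lemma char_poly_conj (R : comUnitRingType) n (A P : 'M[R]_n) :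
  P \in unitmx -> char_poly (invmx P *m A *m P) = char_poly A.
Proof.
move=> Pu; rewrite /char_poly /char_poly_mx.
have -> : 'X%:M - map_mx polyC (invmx P *m A *m P) =
  map_mx polyC (invmx P) *m ('X%:M - map_mx polyC A) *m map_mx polyC P.
  rewrite !map_mxM mulmxBr mulmxBl; congr (_ - _).
  by rewrite -mulmxA mul_scalar_mx -scalemxAr -map_mxM mulVmx// map_mx1 scalemx1.
rewrite !det_mulmx mulrAC -det_mulmx -map_mxM mulVmx// map_mx1 det1 mul1r.
by [].
Qed.

Lemma common_denominator n (u : 'I_n -> rat) :
  exists2 d : int, d != 0 & forall i, exists z : int, d%:~R * u i = z%:~R.
Proof.
exists (\prod_i denq (u i)).
  by apply/prodf_neq0 => i _; rewrite denq_eq0.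
move=> i; exists ((\prod_(j | j != i) denq (u j)) * numq (u i)).
by rewrite (bigD1 i)//= !intrM numqE; ring.
Qed.

(** * Lattices in R^n *)

Section EuclideanLattice.
Variables (R : realType) (n : nat) (L : set 'cV[R]_n).
Hypothesis L0 : L 0.
Hypothesis LB : forall x y, L x -> L y -> L (x - y).

Lemma lattice_opp x : L x -> L (- x).
Proof. by move=> Lx; rewrite -sub0r; exact: LB. Qed.

Lemma lattice_add x y : L x -> L y -> L (x + y).
Proof. by move=> Lx Ly; rewrite -[y]opprK; apply: LB => //; exact: lattice_opp. Qed.

Lemma lattice_natmul k x : L x -> L (k%:R *: x).
Proof.
move=> Lx; elim: k => [|k IH]; first by rewrite scale0r.
by rewrite -natr1 scalerDl scale1r; exact: lattice_add.
Qed.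

Lemma lattice_intmul (k : int) x : L x -> L (k%:~R *: x).
Proof.
move=> Lx; case: k => k; first exact: lattice_natmul.
by rewrite NegzE mulrNz scaleNr; apply: lattice_opp; exact: lattice_natmul.
Qed.

Lemma lattice_mulmx (P : 'M[R]_n) (z : 'cV[int]_n) :
  (forall j, L (col j P)) -> L (P *m map_mx intr z).
Proof.
move=> LP; have -> : P *m map_mx intr z = \sum_j (z j 0)%:~R *: col j P.
  apply/matrixP => i k; rewrite mxE summxE; apply: eq_bigr => j _.
  by rewrite !mxE ord1 mulrC.
elim/big_ind : _ => //; first exact: lattice_add.
by move=> j _; exact: lattice_intmul.
Qed.

(* Lattice points close to the vectors C e_j form a diagonally dominant matrix
   when C is large. *)
Lemma lattice_basis (D : R) : (forall v, exists2 w, L w & `|v - w| <= D) ->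
  exists2 P : 'M[R]_n, P \in unitmx & forall j, L (col j P).
Proof.
move=> dense; have D0 : 0 <= D by have [w _] := dense 0; exact: le_trans.
pose C := n%:R * D + 1.
have /choice[w wP] : forall j : 'I_n, exists w, L w /\ `|C *: delta_mx j 0 - w| <= D.
  by move=> j; have [w] := dense (C *: delta_mx j 0); exists w.
pose P := \matrix_(i, j) w j i 0.
exists P; last first.
  move=> j; suff -> : col j P = w j by have [] := wP j.
  by apply/matrixP => i k; rewrite !mxE ord1.
(* If [u P = 0] then [C u = u E] has norm at most [n D |u|], and [C > n D] forces [u = 0]. *)
rewrite -row_free_unit; apply: inj_row_free => u uP.
pose E := C%:M - P.
have ED : `|E| <= D.
  apply: mx_norm_le => // i j; have [_] := wP j; apply: le_trans.
  have := ler_entry_mx_norm (C *: delta_mx j 0 - w j) i 0.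
  by rewrite !mxE eqxx andbT mulr_natr.
have : u *m E = C *: u by rewrite mulmxBr uP subr0 mul_mx_scalar.
move=> /(congr1 (fun v => `|v|)); rewrite normrZ ger0_norm ?addr_ge0 ?mulr_ge0//.
move=> uE; have := mx_norm_mulmx u E; rewrite uE => h.
have : C * `|u| <= n%:R * D * `|u|.
  apply: le_trans h _; rewrite -mulrA [leRHS]mulrAC -[leRHS]mulrA.
  by rewrite ler_wpM2l// ler_wpM2l.
by rewrite /C mulrDl mul1r gerDl normr_le0 => /eqP.
Qed.

(* Pigeonhole on the fractional parts of the multiples of w. *)
Lemma lattice_denominator (e : R) (P : 'M[R]_n) : 0 < e ->
  (forall w, L w -> `|w| < e -> w = 0) ->
  P \in unitmx -> (forall j, L (col j P)) ->
  exists2 N : nat, (0 < N)%N & forall w, L w ->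
    exists z : 'cV[int]_n, N%:R *: w = P *m map_mx intr z.
Proof.
move=> e0 disc Pu LP.
(* Cells of side [1 / m] are so small that [P] maps the difference of two points of one cell to a
   vector shorter than [e]. *)
have [m m0 mP] : exists2 m : nat, (0 < m)%N & n%:R * `|P| / e < m%:R.
  by exists (Num.truncn (n%:R * `|P| / e)).+1 => //; exact: truncnS_gt.
have m0R : 0 < m%:R :> R by rewrite ltr0n.
pose M := #|{ffun 'I_n -> 'I_m.+1}|.
(* [M] bounds the number of cells. Its factorial is a multiple of every difference [j2 - j1 <= M],
   so a single [N] serves all [w]. *)
exists M`! => [|w Lw]; first exact: fact_gt0.
have [x xE] : exists x : nat -> 'cV[R]_n, forall j, P *m x j = j%:R *: w.
  by exists (fun j => invmx P *m (j%:R *: w)) => j; rewrite mulKVmx.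
pose fl j : 'cV[int]_n := \col_i Num.floor (x j i 0).
pose y j i : R := x j i 0 - (fl j i 0)%:~R.
have y01 j i : 0 <= y j i < 1.
  have := floor_itv (x j i 0); rewrite /y mxE intrD => /andP[h1 h2].
  by rewrite subr_ge0 h1 ltrBlDl.
have my_ge0 j i : 0 <= m%:R * y j i by rewrite mulr_ge0//; case/andP: (y01 j i).
(* The cell of the fractional part of [j w] in the basis [P]; the [M + 1] indices outnumber the
   cells. *)
pose cell (j : 'I_M.+1) := [ffun i => inord (Num.truncn (m%:R * y j i)) : 'I_m.+1].
have [j1 [j2 [j12 cell12]]] : exists j1 j2 : 'I_M.+1, (j1 < j2)%N /\ cell j1 = cell j2.
  apply: contrapT => hn; have : injective cell.
    move=> j1 j2 c12; apply/val_inj; case: (ltngtP j1 j2) => // h; exfalso; apply: hn.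
      by exists j1, j2.
    by exists j2, j1.
  by move/leq_card; rewrite card_ord -/M ltnn.
pose d := (j2 - j1)%N.
have d0 : (0 < d)%N by rewrite subn_gt0.
have dM : (d %| M`!)%N.
  by rewrite dvdn_fact// d0 /= (leq_trans (leq_subr _ _))// -ltnS.
have yy i : `|y j2 i - y j1 i| <= m%:R^-1.
  have := congr1 (fun f : {ffun 'I_n -> 'I_m.+1} => val (f i)) cell12; rewrite !ffunE /=.
  have tm j : (Num.truncn (m%:R * y j i) < m.+1)%N.
    rewrite truncn_lt_nat// (lt_trans (y := m%:R))// ?ltr_nat//.
    by rewrite -[ltRHS]mulr1 ltr_pM2l//; case/andP: (y01 j i).
  rewrite !inordK// => tt.
  have /andP[a1 a2] := truncn_itv (my_ge0 j1 i).
  have /andP[b1 b2] := truncn_itv (my_ge0 j2 i).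
  rewrite tt -natr1 in a1 a2; rewrite -natr1 in b2.
  rewrite -(ler_pM2l m0R) mulfV ?gt_eqF// -[m%:R in leLHS]ger0_norm// -normrM.
  rewrite mulrBr ler_norml; lra.
pose dy : 'cV[R]_n := \col_i (y j2 i - y j1 i).
have dyE : P *m dy = d%:R *: w - P *m map_mx intr (fl j2 - fl j1).
  have -> : dy = x j2 - x j1 - map_mx intr (fl j2 - fl j1).
    apply/matrixP => i k; rewrite ord1 !mxE /y !mxE intrB; ring.
  rewrite !mulmxBr !xE /d natrB; last exact: ltnW.
  by rewrite scalerBl.
(* The difference of the two fractional parts is a point of [L] shorter than [e], hence 0: [d w] has
   integral coordinates. *)
have Ldy : L (P *m dy).
  by rewrite dyE; apply: LB; [exact: lattice_natmul|exact: lattice_mulmx].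
have Pdy0 : P *m dy = 0.
  apply: disc => //; apply: le_lt_trans (mx_norm_mulmx _ _) _.
  have dym : `|dy| <= m%:R^-1.
    by apply: mx_norm_le => [|i k]; rewrite ?invr_ge0// mxE.
  apply: le_lt_trans (ler_wpM2l _ dym) _; first by rewrite mulr_ge0.
  by move: mP; rewrite !ltr_pdivrMr// [m%:R * e]mulrC.
exists ((M`! %/ d)%N%:Z *: (fl j2 - fl j1)).
have -> : (M`!)%:R *: w = (M`! %/ d)%N%:R *: (d%:R *: w).
  by rewrite scalerA -natrM divnK.
move/eqP: dyE; rewrite Pdy0 eq_sym subr_eq0 => /eqP ->.
by rewrite scalemxAr map_mxZ.
Qed.

(** Otherwise the values of [K u] on the iterates [C ^+ k w0] would be nonzero integers
    [beta ^+ k * x] tending to 0. *)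
Lemma integral_eigenform_norm (K beta : R) (u : 'rV[R]_n) (C : 'M[R]_n) w0 :
  K != 0 -> beta != 0 -> (forall w, L w -> exists z : int, K * (u *m w) 0 0 = z%:~R) ->
  (forall w, L w -> L (C *m w)) -> u *m C = beta *: u ->
  L w0 -> (u *m w0) 0 0 != 0 -> 1 <= `|beta|.
Proof.
move=> K0 b0 uint LC uC Lw0 uw0; rewrite leNgt; apply/negP => beta1.
pose x := K * (u *m w0) 0 0; have x0 : x != 0 by rewrite mulf_neq0.
have xk k : exists z : int, beta ^+ k * x = z%:~R.
  have [w [Lw uw]] : exists w, L w /\ u *m w = beta ^+ k *: (u *m w0).
    elim: k => [|k [w [Lw uw]]]; first by exists w0; rewrite expr0 scale1r.
    exists (C *m w); split; first exact: LC.
    by rewrite mulmxA uC -scalemxAl uw scalerA exprS.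
  have [z uz] := uint w Lw; exists z; rewrite -uz uw [X in _ = K * X]mxE /x; ring.
have := cvg_expr beta1 => /cvgrPdist_lt/(_ `|x|^-1).
rewrite invr_gt0 normr_gt0 => /(_ x0)[k _ /(_ k (leqnn k))] /=.
rewrite sub0r normrN -(ltr_pM2r (x := `|x|)) ?normr_gt0// mulVf ?normr_eq0//.
rewrite -normrM; have [z zE] := xk k.
have bx0 : beta ^+ k * x != 0 by rewrite mulf_neq0// expf_neq0.
rewrite zE -intr_norm -[1]/(1%:~R) ltr_int ltNge -gtz0_ge1 normr_gt0.
by move: bx0; rewrite zE intr_eq0 => ->.
Qed.

Lemma lattice_no_odd_eigenvalue (D e alpha : R) (B B' : 'M[R]_n) (g : {poly R}) :
  (forall v, exists2 w, L w & `|v - w| <= D) ->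
  0 < e -> (forall w, L w -> `|w| < e -> w = 0) ->
  B *m B' = 1%:M ->
  (forall w, L w -> L (B *m w)) -> (forall w, L w -> L (B' *m w)) ->
  0 < alpha -> alpha != 1 ->
  char_poly B = ('X - alpha%:P) * g ^+ 2 -> False.
Proof.
move=> dense e0 disc BB' LBw LB'w alpha0 alpha1 cB.
have [P Pu LP] := lattice_basis dense.
have [N N0 NP] := lattice_denominator e0 disc Pu LP.
have NR0 : N%:R != 0 :> R by rewrite pnatr_eq0 -lt0n.
have /choice[z zP] : forall j, exists z : 'cV[int]_n,
    N%:R *: (B *m col j P) = P *m map_mx intr z.
  by move=> j; apply: NP; apply: LBw.
(* The matrix of [B] in the basis [P]: the images of the basis vectors are in [L], so their
   coordinates have denominator [N]. *)
pose Q : 'M[rat]_n := \matrix_(i, j) ((z j i 0)%:~R / N%:R).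
have BP : B *m P = P *m map_mx ratr Q.
  apply/matrixP => i j; apply: (mulfI NR0).
  transitivity ((N%:R *: (B *m col j P)) i 0).
    by rewrite [RHS]mxE colE mulmxA -colE [in RHS]mxE.
  rewrite zP !mxE mulr_sumr; apply: eq_bigr => k _.
  by rewrite !mxE fmorph_div /= ratr_int ratr_nat; field.
have QE : map_mx ratr Q = invmx P *m B *m P by rewrite -mulmxA BP mulKmx.
have fE : map_poly ratr (char_poly Q) = char_poly B.
  by rewrite map_char_poly QE char_poly_conj.
have f0 : char_poly Q != 0 by exact/monic_neq0/char_poly_monic.
have [q alphaE] : exists q : rat, alpha = ratr q.
  exact: (odd_root_rational f0 (etrans fE cB)).
have : eigenvalue Q q.
  rewrite eigenvalue_root_char.
  suff: root (map_poly ratr (char_poly Q)) (ratr q : R) by rewrite fmorph_root.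
  rewrite fE cB -alphaE.
  by rewrite rootM root_XsubC eqxx.
case/eigenvalueP => v vQ v0.
(* A rational left eigenvector of [Q], transported to the standard basis. *)
pose u : 'rV[R]_n := map_mx ratr v *m invmx P.
have uP : u *m P = map_mx ratr v by rewrite mulmxKV.
have uB : u *m B = alpha *: u.
  rewrite -[LHS](mulmxK Pu) -[u *m B *m P]mulmxA BP mulmxA uP -map_mxM vQ.
  by rewrite map_mxZ -scalemxAl alphaE.
have uB' : u *m B' = alpha^-1 *: u.
  have := congr1 (mulmxr B') uB; rewrite /= -mulmxA BB' mulmx1 -scalemxAl => uE.
  by rewrite [X in _ = _ *: X]uE scalerA mulVf ?gt_eqF// scale1r.
have [d d0 dP] := common_denominator (fun i => v 0 i).
have dR0 : d%:~R * N%:R != 0 :> R by rewrite mulf_neq0// intr_eq0.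
(* [N] clears the coordinates of [w] in the basis [P], and [d] clears those of [v]. *)
have uint w : L w -> exists t : int, d%:~R * N%:R * (u *m w) 0 0 = t%:~R.
  move=> Lw; have [y yE] := NP w Lw; have /choice[t tP] := dP.
  exists (\sum_i t i * y i 0).
  have -> : d%:~R * N%:R * (u *m w) 0 0 = d%:~R * (u *m (N%:R *: w)) 0 0.
    by rewrite -scalemxAr [in RHS]mxE mulrA.
  rewrite yE mulmxA uP mxE mulr_sumr rmorph_sum; apply: eq_bigr => i _.
  rewrite !mxE mulrA /= intrM; congr (_ * _).
  by rewrite -(ratr_int R d) -rmorphM tP /= ratr_int.
have [j vj] : exists j, v 0 j != 0 by exact/rV0Pn.
have uw0 : (u *m col j P) 0 0 != 0.
  by rewrite colE mulmxA uP -colE !mxE fmorph_eq0.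
have a0 : alpha != 0 by rewrite gt_eqF.
have a0' : alpha^-1 != 0 by rewrite invr_eq0.
(* Applied to [B] and to its inverse, the bound gives [|alpha| >= 1] and [|alpha^-1| >= 1]. *)
have h1 := integral_eigenform_norm dR0 a0 uint LBw uB (LP j) uw0.
have := integral_eigenform_norm dR0 a0' uint LB'w uB' (LP j) uw0.
rewrite normfV invf_ge1 ?normr_gt0 ?gt_eqF// => h2.
have : `|alpha| == 1 by rewrite eq_le h1 h2.
by rewrite gtr0_norm// (negbTE alpha1).
Qed.

End EuclideanLattice.

(** * Lattices in the semidirect product *)

Section SemidirectLattice.
Variables (R : realType) (n : nat) (A : 'M[R]_n).
Local Notation G := (semidirect A).

Lemma sd_mulE (x y : G) :
  (x * y)%g = (x.1 + y.1, x.2 + expmx (x.1 *: A) *m y.2).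
Proof. by []. Qed.

Lemma sd_invE (x : G) : (x^-1)%g = (- x.1, - (expmx (- x.1 *: A) *m x.2)).
Proof. by []. Qed.

Lemma sd_mulgA (x y z : G) : (x * (y * z) = x * y * z)%g.
Proof.
by rewrite !sd_mulE /= mulmxDr mulmxA -expmxD !addrA.
Qed.

Lemma sd_mul1g (x : G) : (1 * x = x)%g.
Proof.
by case: x => [t v]; rewrite sd_mulE /= add0r scale0r expmx0 mul1mx add0r.
Qed.

Lemma sd_mulVg (x : G) : (x^-1 * x = 1)%g.
Proof.
by rewrite sd_mulE sd_invE /= addNr addNr.
Qed.

Lemma continuous_mulmx m p (M : 'M[R]_(m, n)) :
  continuous (fun N : 'M[R]_(n, p) => M *m N).
Proof.
move=> N; apply/(@cvgrPdist_lt _ _ _ (nbhs N) (nbhs_filter N)) => e e0.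
have c0 : 0 < n%:R * `|M| + 1 by rewrite ltr_wpDl// mulr_ge0.
apply/nbhs_ballP; exists (e / (n%:R * `|M| + 1)) => [|N'] /=; first by rewrite divr_gt0.
rewrite -ball_normE /= ltr_pdivlMr// => h.
rewrite -mulmxBr (le_lt_trans (mx_norm_mulmx _ _))// (le_lt_trans _ h)//.
by rewrite [leRHS]mulrC ler_wpM2r// lerDl.
Qed.

(** * Bounded representatives of the cosets and translations in a lattice *)

Variable Gamma : set G.
Hypothesis Gamma_lattice : is_lattice Gamma.

Let Gamma1 : Gamma 1%g. Proof. by case: Gamma_lattice => [[]]. Qed.
Let GammaM x y : Gamma x -> Gamma y -> Gamma (x * y)%g.
Proof. by case: Gamma_lattice => [[_ h _] _ _]; exact: h. Qed.
Let GammaV x : Gamma x -> Gamma (x^-1)%g.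
Proof. by case: Gamma_lattice => [[_ _ h] _ _]; exact: h. Qed.

Lemma coset_at_mull x (g : G) : Gamma x -> coset_at Gamma (x * g)%g = coset_at Gamma g.
Proof.
move=> Gx; apply/seteqP; split=> _ [y Gy <-].
  by exists (y * x)%g; [exact: GammaM|rewrite sd_mulgA].
exists (y * x^-1)%g; first by apply: GammaM => //; exact: GammaV.
by rewrite sd_mulgA -(sd_mulgA y) sd_mulVg -sd_mulgA sd_mul1g.
Qed.

Lemma coset_at_inj (g h : G) : coset_at Gamma g = coset_at Gamma h ->
  exists2 x, Gamma x & g = (x * h)%g.
Proof.
move=> gh; have [x Gx xh] : coset_at Gamma h g.
  by rewrite -gh; exists 1%g => //; rewrite sd_mul1g.
by exists x.
Qed.

(** The images [U k] of the open boxes of size [k] are open, increase with [k] and cover the compact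
    quotient, so one of them is everything. *)
Lemma lattice_bounded_domain : exists2 k : R, 0 < k & forall g : G,
  exists x h : G, [/\ Gamma x, g = (x * h)%g, `|h.1| <= k & `|h.2| <= k].
Proof.
have [_ _ /compact_near_coveringP cpt] := Gamma_lattice.
pose pi (g : G) : coset_space Gamma := \pi_{eq_quot coset_equiv Gamma} g.
have piP g h : pi g = pi h <-> coset_at Gamma g = coset_at Gamma h.
  by split=> [/eqquotP/asboolP//|gh]; apply/eqquotP/asboolP.
pose U (k : R) (q : coset_space Gamma) :=
  exists h : G, [/\ pi h = q, `|h.1| < k & `|h.2| < k].
have Uopen k : open (U k).
  (* A point [g] over [U k] has [x g] in the box for some [x] in [Gamma]; by continuity the same [x]
     works near [g]. *)
  rewrite /open /= /quotient_open openE => g [h [/piP/coset_at_inj[x Gx hE] h1 h2]].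
  rewrite /interior /=.
  have f1 : (fun g' : R * 'cV[R]_n => `|x.1 + g'.1|) g' @[g' --> g] --> `|x.1 + g.1|.
    by apply: cvg_norm; apply: cvgD; [exact: cvg_cst|exact: cvg_fst].
  have f2 : (fun g' : R * 'cV[R]_n => `|x.2 + expmx (x.1 *: A) *m g'.2|) g' @[g' --> g]
       --> `|x.2 + expmx (x.1 *: A) *m g.2|.
    apply: cvg_norm; apply: cvgD; first exact: cvg_cst.
    by apply: continuous_cvg; [exact: continuous_mulmx|exact: cvg_snd].
  rewrite hE in h1 h2.
  have n1 := cvgr_lt _ f1 _ h1; have n2 := cvgr_lt _ f2 _ h2.
  have FF := nbhs_filter g.
  apply: (@filterS _ _ FF _ _ _ (@filterI _ _ FF _ _ (n1 FF) (n2 FF))) => g' [/= g1 g2].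
  exists (x * g')%g; split=> //.
  by apply/piP; exact: coset_at_mull.
have : \forall k \near +oo, [set: coset_space Gamma] `<=` U k.
  apply: cpt => q _; pose g : G := repr q; pose k0 := `|g.1| + `|g.2| + 1.
  exists (U k0, [set k | k0 <= k]) => /=.
    split; last by exists k0; split; [exact: num_real|move=> x /= /ltW].
    apply: (@open_nbhs_nbhs (coset_space Gamma) q); split; first exact: Uopen.
    exists g; split; first exact: reprK.
      by rewrite /k0 -addrA ltrDl ltr_wpDl.
    by rewrite /k0 addrAC ltrDr ltr_wpDl.
  move=> [q' k] /= [[h [hq h1 h2]] kk]; exists h; split=> //; exact: lt_le_trans kk.
move=> [M [_ hM]]; exists (`|M| + 1); first by rewrite ltr_wpDl.
move=> g; have [|h [/piP/esym/coset_at_inj[x Gx gE] h1 h2]] := hM (`|M| + 1) _ (pi g) I.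
- by rewrite (le_lt_trans (ler_norm _))// ltrDl.
- by exists x, h; split=> //; exact: ltW.
Qed.

(** The group [L] of translations contained in [Gamma]. *)
Definition time0 : set 'cV[R]_n := [set v | Gamma (0, v)].

Lemma time0_sub t v w : Gamma (t, v) -> Gamma (t, w) -> time0 (v - w).
Proof.
move=> Gv Gw; have := GammaM Gv (GammaV Gw).
rewrite sd_mulE sd_invE /= subrr mulmxN mulmxA -expmxD subrr scale0r.
by rewrite expmx0 mul1mx.
Qed.

Lemma time0_0 : time0 0. Proof. exact: Gamma1. Qed.

(** The product [(t, v) (0, w)] has the same time as [(t, v)], and elements of equal time differ by
    a translation. *)
Lemma time0_expmx x w : Gamma x -> time0 w -> time0 (expmx (x.1 *: A) *m w).
Proof.
case: x => t v Gx Lw.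
have -> : expmx (t *: A) *m w = v + expmx (t *: A) *m w - v by rewrite addrC addKr.
apply: (time0_sub _ Gx).
by have := GammaM Gx Lw; rewrite sd_mulE /= addr0.
Qed.

Lemma time0_discrete : exists2 e : R, 0 < e & forall w, time0 w -> `|w| < e -> w = 0.
Proof.
have [_ /(_ _ Gamma1)[_ [V nV VG]] _] := Gamma_lattice.
move: nV => [[V1 V2] /= [n1 n2] V12].
have [e /= e0 he] := (nbhs_ballP _ _).1 n2.
exists e => // w Gw we.
have : (V `&` Gamma) (0, w).
  split=> //; apply: V12; split=> /=; first exact: nbhs_singleton n1.
  by apply: he; rewrite -ball_normE /= sub0r normrN.
by rewrite VG /= => -[].
Qed.

Lemma lattice_nonzero_time : exists2 x, Gamma x & x.1 != 0.
Proof.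
have [k k0 kP] := lattice_bounded_domain.
(* An element of time [k + 1] is [x h] with [h] of time at most [k], so [x] has nonzero time. *)
have [x [h [Gx /(congr1 fst)/= xh h1 _]]] := kP (k + 1, 0).
exists x => //; apply/eqP => x0; move: h1; rewrite x0 add0r in xh.
by rewrite -xh ger0_norm ?addr_ge0 ?(ltW k0)// gerDl ler10.
Qed.

(** * Discreteness of the times and density of the translations *)

Section Eigenform.
Variable u : 'rV[R]_n.
Hypothesis u0 : u != 0.
Hypothesis uA : u *m A = u.

Let form (v : 'cV[R]_n) : R := (u *m v) 0 0.
Let formD v w : form (v + w) = form v + form w.
Proof. by rewrite /form mulmxDr mxE. Qed.
Let formN v : form (- v) = - form v.
Proof. by rewrite /form mulmxN mxE. Qed.
Let form_exp t v : form (expmx (t *: A) *m v) = expR t * form v.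
Proof. by rewrite /form mulmxA eigen_expmx// -scalemxAl mxE. Qed.

(** For a small nonzero time [s], the vector [exp (s A) w - w] is in [L] and shorter than [e], hence
    0; the eigenform then gives [(e^s - 1) form w = 0]. *)
Lemma form_time0_eq0 :
  (forall d : R, 0 < d -> exists x, [/\ Gamma x, `|x.1| < d & x.1 != 0]) ->
  forall w, time0 w -> form w = 0.
Proof.
move=> small w Lw; have [e e0 disc] := time0_discrete.
have c0 : 0 < n%:R * `|w| + 1 by rewrite ltr_wpDl// mulr_ge0.
have [d d0 dP] := cvg_expmx0 A (divr_gt0 e0 c0).
have [x [Gx xd x0]] := small d d0.
have : expmx (x.1 *: A) *m w - w = 0.
  apply: disc; first by apply: (time0_sub _ Lw); exact: time0_expmx.
  rewrite -[X in _ - X]mul1mx -mulmxBl.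
  have h := mx_norm_mulmx (expmx (x.1 *: A) - 1%:M) w.
  apply: le_lt_trans h _; rewrite mulrAC.
  apply: le_lt_trans (ler_wpM2l _ (dP _ xd)) _; first by rewrite mulr_ge0.
  by rewrite mulrA ltr_pdivrMr// mulrC ltr_pM2l// ltrDl.
move/(congr1 form); rewrite formD formN form_exp [form 0]/form mulmx0 mxE.
move/eqP; rewrite -[X in _ - X]mul1r -mulrBl mulf_eq0 subr_eq0 => /orP[|/eqP//].
by rewrite -expR0 (inj_eq (@expR_inj R)) (negbTE x0).
Qed.

(* If the times of Gamma accumulated at 0, the eigenform would map Gamma onto an
   abelian subgroup of the ax+b group, contained in a curve
   (s, c (e^s - 1)); such a subgroup is not cocompact. *)
Lemma lattice_times_discrete : exists2 d : R, 0 < d &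
  forall x, Gamma x -> `|x.1| < d -> x.1 = 0.
Proof.
apply: contrapT => hn.
have {}hn : forall d : R, 0 < d -> exists x, [/\ Gamma x, `|x.1| < d & x.1 != 0].
  move=> d d0; apply: contrapT => h; apply: hn; exists d => // x Gx xd.
  by apply/eqP; apply: contrapT => /negP x0; apply: h; exists x.
have f0 := form_time0_eq0 hn.
(* [x y] and [y x] have the same time, so they differ by a translation of [L], which the form
   kills. *)
have comm x y : Gamma x -> Gamma y ->
    form x.2 + expR x.1 * form y.2 = form y.2 + expR y.1 * form x.2.
  move=> Gx Gy; apply/eqP; rewrite -subr_eq0 -!form_exp -!formD -formN -formD.
  apply/eqP/f0; apply: (time0_sub (t := x.1 + y.1)); first exact: (GammaM Gx Gy).
  by rewrite addrC; exact: (GammaM Gy Gx).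
have [x0 Gx0 x00] := lattice_nonzero_time.
have e1 : expR x0.1 - 1 != 0.
  by rewrite subr_eq0 -expR0 (inj_eq (@expR_inj R)).
pose c := form x0.2 / (expR x0.1 - 1).
have curve y : Gamma y -> form y.2 = c * (expR y.1 - 1).
  move=> Gy; apply: (mulfI e1); rewrite /c; have := comm _ _ Gx0 Gy => h.
  have -> : (expR x0.1 - 1) * (form x0.2 / (expR x0.1 - 1) * (expR y.1 - 1)) =
     form x0.2 * (expR y.1 - 1) by field.
  lra.
have [j uj] : exists j, u 0 j != 0 by exact/rV0Pn.
have [k k0 kP] := lattice_bounded_domain.
(* [Y] bounds the form at every [v] with [(0, v) = x h] and [h] in the box, since then [|x.1| <= k];
   the vector [v] below exceeds this bound. *)
pose Y := `|c| * (expR k + 1) + expR k * (n%:R * `|u| * k).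
pose v : 'cV[R]_n := (Y + 1) *: ((u 0 j)^-1 *: delta_mx j 0).
have fv : form v = Y + 1.
  by rewrite /form /v -!scalemxAr -colE !mxE mulVf// mulr1.
have [x [h [Gx xh h1 h2]]] := kP (0, v).
have xk : expR x.1 <= expR k.
  rewrite ler_expR; have /(congr1 fst)/= := xh.
  by move: h1; rewrite ler_norml => /andP[? ?] ?; lra.
have fh : `|form h.2| <= n%:R * `|u| * k.
  apply: le_trans (ler_entry_mx_norm _ _ _) _.
  apply: le_trans (mx_norm_mulmx _ _) _.
  by rewrite ler_wpM2l// mulr_ge0.
have Y0 : 0 <= Y.
  by rewrite addr_ge0// mulr_ge0 ?addr_ge0 ?expR_ge0// !mulr_ge0// ltW.
have : `|form v| <= Y.
  have /(congr1 snd)/= -> := xh; rewrite formD form_exp curve//.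
  apply: le_trans (ler_normD _ _) _.
  rewrite (normrM c) (normrM (expR x.1)) (ger0_norm (expR_ge0 _)).
  apply: lerD; last by apply: ler_pM; rewrite ?expR_ge0.
  rewrite ler_wpM2l// (le_trans (ler_normB _ _))// normr1 (ger0_norm (expR_ge0 _)).
  by rewrite lerD2r.
by rewrite fv (ger0_norm (addr_ge0 Y0 ler01)) gerDl ler10.
Qed.

(** Write [(0, v) = x h] with [h] bounded. The time of [x] takes finitely many values in [[-k, k]];
    subtracting a fixed element of [Gamma] of that time leaves a translation near [v]. *)
Lemma time0_dense : exists D : R, forall v, exists2 w, time0 w & `|v - w| <= D.
Proof.
have [k k0 kP] := lattice_bounded_domain.
have [d d0 dP] := lattice_times_discrete.
(* One element of [Gamma] per time slot of length [d], with default [1] for an empty slot. *)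
have /choice[f fP] : forall j : int, exists y : G,
    (exists2 x, Gamma x & Num.floor (x.1 / d) = j) ->
    Gamma y /\ Num.floor (y.1 / d) = j.
  move=> j; have [[y Gy yj]|h] := pselect (exists2 x, Gamma x & Num.floor (x.1 / d) = j).
    by exists y.
  by exists 1%g.
pose M := (Num.truncn (k / d)).+1.
have kM : k / d < M%:R by exact: truncnS_gt.
pose b (y : G) := `|y.2| + n%:R * `|expmx (y.1 *: A)| * k.
have b0 y : 0 <= b y by rewrite addr_ge0// !mulr_ge0// ltW.
(* The slots [-M <= j < M] cover [[-k, k]]; the sum of the nonnegative bounds dominates each of
   them. *)
exists (\sum_(i < M + M) b (f (i%:Z - M%:Z))) => v.
have [x [h [Gx xh h1 h2]]] := kP (0, v).
have [Gy yj] := fP _ (ex_intro2 _ _ x Gx erefl).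
move: yj; set j := Num.floor (x.1 / d); move: Gy; rewrite -/j; set y := f j => Gy yj.
(* Two times in one slot differ by less than [d], hence are equal. *)
have xy : y.1 = x.1.
  apply/eqP; rewrite -subr_eq0; apply/eqP.
  apply: (dP _ (GammaM Gy (GammaV Gx))) => /=.
  have /andP[a1 a2] := floor_itv (x.1 / d); have /andP[a3 a4] := floor_itv (y.1 / d).
  rewrite yj -/j in a1 a2 a3 a4; rewrite intrD in a2 a4.
  rewrite -[ltRHS]mul1r -ltr_pdivrMr// -[d in _ / d](ger0_norm (ltW d0)).
  rewrite -normf_div mulrBl ltr_norml.
  by apply/andP; split; lra.
have x1k : `|x.1 / d| <= k / d.
  rewrite normf_div (ger0_norm (ltW d0)) ler_pM2r ?invr_gt0//.
  have /(congr1 fst)/= /eqP := xh; rewrite eq_sym addr_eq0 => /eqP ->.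
  by rewrite normrN.
have jM1 : (- M%:Z <= j)%R.
  rewrite /j floor_ge_int intrN; move: x1k; rewrite ler_norml => /andP[+ _].
  by apply: le_trans; rewrite lerNl opprK ltW.
have jM2 : (j < M%:Z)%R.
  by rewrite floor_lt_int (le_lt_trans _ kM)// (le_trans (ler_norm _)).
exists (x.2 - y.2).
  by apply: (time0_sub (t := x.1)); [case: (x) Gx|rewrite -xy; case: (y) Gy].
have -> : v - (x.2 - y.2) = y.2 + expmx (y.1 *: A) *m h.2.
  by have /(congr1 snd)/= -> := xh; rewrite xy opprB addrC addrA subrK.
have byb : `|y.2 + expmx (y.1 *: A) *m h.2| <= b y.
  apply: le_trans (ler_normD _ _) _; rewrite lerD2l.
  by apply: le_trans (mx_norm_mulmx _ _) _; rewrite ler_wpM2l// mulr_ge0.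
apply: le_trans byb _.
have iM : (absz (j + M%:Z)%R < M + M)%N by lia.
have jE : (absz (j + M%:Z))%:Z - M%:Z = j by lia.
by rewrite (bigD1 (Ordinal iM))//= jE lerDl sumr_ge0.
Qed.

End Eigenform.
End SemidirectLattice.

(** Take [B = exp (t A)] for the nonzero time [t] of some [x] in [Gamma]; its inverse preserves [L]
    because [x^-1] is in [Gamma]. *)
Lemma odd_eigenvalue_no_lattice (R : realType) n (A : 'M[R]_n) (u : 'rV[R]_n) :
  u != 0 -> u *m A = u ->
  (forall t, exists g, char_poly (expmx (t *: A)) = ('X - (expR t)%:P) * g ^+ 2) ->
  ~ admits_lattice A.
Proof.
move=> u0 uA cp [Gamma GL].
have [D dense] := time0_dense GL u0 uA.
have [e e0 disc] := time0_discrete GL.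
have [x Gx x0] := lattice_nonzero_time GL.
have [g cg] := cp x.1.
have GV : Gamma (x^-1)%g by case: GL => [[_ _ h] _ _]; exact: h.
apply: (lattice_no_odd_eigenvalue (time0_0 GL) _ dense e0 disc (expmxKN A x.1) _ _
  (expR_gt0 x.1) _ cg).
- by move=> v w; exact: time0_sub.
- by move=> w; exact: time0_expmx.
- by move=> w; exact: (time0_expmx GL GV).
- by rewrite -expR0 (inj_eq (@expR_inj R)).
Qed.

(** * Block matrices *)

Lemma char_poly_lblock (R : comNzRingType) m n
    (A : 'M[R]_m) (C : 'M[R]_(n, m)) (D : 'M[R]_n) :
  char_poly (block_mx A 0 C D) = char_poly A * char_poly D.
Proof.
rewrite /char_poly /char_poly_mx map_block_mx scalar_mx_block opp_block_mx.
by rewrite add_block_mx map_mx0 oppr0 addr0 det_lblock.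
Qed.

Lemma char_poly_tr (R : comNzRingType) n (A : 'M[R]_n) : char_poly A^T = char_poly A.
Proof.
by rewrite /char_poly -det_tr /char_poly_mx linearB /= tr_scalar_mx map_trmx trmxK.
Qed.

(** * Squares in the characteristic polynomials of exponentials *)

Section BlockExponential.
Variable R : realType.

Definition exp_square n (A : 'M[R]_n) :=
  forall t, exists g, char_poly (expmx (t *: A)) = g ^+ 2.

Definition exp_odd n (A : 'M[R]_n) :=
  (exists2 u : 'rV_n, u != 0 & u *m A = u) /\
  forall t, exists g, char_poly (expmx (t *: A)) = ('X - (expR t)%:P) * g ^+ 2.

Lemma char_poly_expmx_lblock m n t (A : 'M[R]_m) (C : 'M[R]_(n, m)) (D : 'M[R]_n) :
  char_poly (expmx (t *: block_mx A 0 C D)) =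
  char_poly (expmx (t *: A)) * char_poly (expmx (t *: D)).
Proof.
rewrite scale_block_mx scaler0.
by have [C' ->] := expmx_lblock (t *: A) (t *: C) (t *: D); rewrite char_poly_lblock.
Qed.

Lemma exp_square_lblock m n (A : 'M[R]_m) (C : 'M[R]_(n, m)) (D : 'M[R]_n) :
  exp_square A -> exp_square D -> exp_square (block_mx A 0 C D).
Proof.
move=> sA sD t; have [a aE] := sA t; have [d dE] := sD t.
by exists (a * d); rewrite char_poly_expmx_lblock aE dE exprMn.
Qed.

(** The off-diagonal block does not affect the characteristic polynomial, so equal diagonal blocks
    give a square. *)
Lemma exp_square_twice n (A C : 'M[R]_n) : exp_square (block_mx A 0 C A).
Proof.
by move=> t; rewrite char_poly_expmx_lblock; exists (char_poly (expmx (t *: A))).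
Qed.

Lemma exp_square_scalar4 a : exp_square (a%:M : 'M[R]_4).
Proof. by have := @exp_square_twice 2 a%:M 0; rewrite -scalar_mx_block. Qed.

Lemma Kmx_block a b :
  let K := mx_of_rows 2 2 [:: [:: a; - b]; [:: b; a]] in
  Kmx a b = block_mx K 0 0 K^T :> 'M[R]_(2 + 2).
Proof.
move=> K; apply/matrixP => i j; rewrite !mxE.
by case: splitP => i' ii; rewrite !mxE; case: splitP => j' jj; rewrite !mxE ii jj;
  case: i' j' {ii jj} => [[|[|?]] ?] [[|[|?]] ?].
Qed.

(** The two diagonal blocks are transposes of each other, and so are their exponentials. *)
Lemma exp_square_Kmx a b : exp_square (Kmx a b).
Proof.
rewrite Kmx_block; set K := mx_of_rows 2 2 _.
suff : @exp_square (2 + 2) (block_mx K 0 0 K^T) by [].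
move=> t; rewrite char_poly_expmx_lblock -linearZ /= expmx_tr char_poly_tr -expr2.
by eexists.
Qed.

(** The cube of [X - e^t] is one factor times a square. *)
Lemma exp_odd_1 : exp_odd (1%:M : 'M[R]_3).
Proof.
split.
  exists (delta_mx 0 0); last by rewrite mulmx1.
  by apply/rV0Pn; exists 0; rewrite mxE oner_eq0.
move=> t; exists ('X - (expR t)%:P); rewrite scalemx1 expmx_scalar.
rewrite char_poly_trig; last exact: scalar_mx_is_trig.
under eq_bigr do rewrite mxE eqxx mulr1n.
by rewrite prodr_const card_ord exprS.
Qed.

Lemma exp_odd_lblock m n (A : 'M[R]_m) (C : 'M[R]_(n, m)) (D : 'M[R]_n) :
  exp_odd A -> exp_square D -> exp_odd (block_mx A 0 C D).
Proof.
move=> [[u u0 uA] oA] sD; split.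
  exists (row_mx u 0); last by rewrite mul_row_block !mul0mx !mulmx0 !addr0 uA.
  by apply: contraNneq u0; rewrite -row_mx0 => /eq_row_mx[->].
move=> t; have [a aE] := oA t; have [d dE] := sD t.
by exists (a * d); rewrite char_poly_expmx_lblock aE dE exprMn -mulrA.
Qed.

Lemma exp_odd_no_lattice n (A : 'M[R]_n) : exp_odd A -> ~ admits_lattice A.
Proof. by move=> [[u u0 uA] oA]; exact: odd_eigenvalue_no_lattice u0 uA oA. Qed.

(** [ad x] sends [e_0] into the ideal and acts on the ideal as [x.1 A]. *)
Lemma unimodular_mxtrace n (A : 'M[R]_n) : \tr A = 0 -> unimodular A.
Proof.
move=> trA x; rewrite /trace_ad /sd_bracket /= add0r.
transitivity (x.1 * \tr A); last by rewrite trA mulr0.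
rewrite /mxtrace mulr_sumr; apply: eq_bigr => i _.
by rewrite scale0r subr0 mxE -colE mxE.
Qed.

Lemma unimodular_lblock m n (A : 'M[R]_m) (C : 'M[R]_(n, m)) (D : 'M[R]_n) :
  \tr A + \tr D = 0 -> unimodular (block_mx A 0 C D).
Proof. by move=> tr0; apply: unimodular_mxtrace; rewrite mxtrace_block. Qed.

Lemma mxtrace_Kmx a b : \tr (Kmx a b) = 4 * a :> R.
Proof. by rewrite /mxtrace !big_ord_recl big_ord0 !mxE /=; ring. Qed.

End BlockExponential.

Theorem proposition6p4 (R : realType) :
  (forall a b c d : R, a + c = - (3 / 4) -> 0 < b -> b < d ->
     unimodular (S3 a b c d) /\ ~ admits_lattice (S3 a b c d)) /\
  (forall a b c : R, a <= c -> a + c = - (3 / 4) -> 0 < b ->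
     unimodular (S4 a b c) /\ ~ admits_lattice (S4 a b c)) /\
  (forall a c d : R, a + c = - (3 / 4) -> 0 < d ->
     unimodular (S7 a c d) /\ ~ admits_lattice (S7 a c d)) /\
  (forall d : R, 0 < d ->
     unimodular (S8 (- (7 / 4)) d) /\ ~ admits_lattice (S8 (- (7 / 4)) d)) /\
  (forall a c : R, a <= c -> a + c = - (3 / 4) ->
     unimodular (S11 a c) /\ ~ admits_lattice (S11 a c)) /\
  (unimodular (S12 (- (7 / 4) : R)) /\ ~ admits_lattice (S12 (- (7 / 4) : R))) /\
  (forall b : R, 0 < b ->
     unimodular (S14 (- (3 / 8)) b) /\ ~ admits_lattice (S14 (- (3 / 8)) b)) /\
  (unimodular (S17 (- (3 / 8) : R)) /\ ~ admits_lattice (S17 (- (3 / 8) : R))).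
Proof.
have IUI_odd : exp_odd (@IUI R).
  exact: exp_odd_lblock (exp_odd_1 R) (exp_square_scalar4 1).
(* [odd3] serves the matrices starting with [I_3], [odd7] those starting with [IUI], and [sum88]
   joins two blocks of size 4. *)
have odd3 := exp_odd_lblock 0 (exp_odd_1 R).
have odd7 := exp_odd_lblock 0 IUI_odd.
have sum88 (A B : 'M[R]_4) := @exp_square_lblock R 4 4 A 0 B.
split=> [a b c d ac _ _|].
  split; last exact/exp_odd_no_lattice/odd3/sum88/exp_square_Kmx/exp_square_Kmx.
  apply: (@unimodular_lblock R 3 (4 + 4)).
  (* The trace is [3 + 4 (a + c) = 0]. *)
  rewrite mxtrace_scalar mxtrace_block !mxtrace_Kmx.
  by lra.
split=> [a b c _ ac _|].
  split; last exact/exp_odd_no_lattice/odd3/sum88/exp_square_Kmx/exp_square_Kmx.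
  apply: (@unimodular_lblock R 3 (4 + 4)).
  rewrite mxtrace_scalar mxtrace_block !mxtrace_Kmx.
  by lra.
split=> [a c d ac _|].
  split; last exact/exp_odd_no_lattice/odd3/sum88/exp_square_Kmx/exp_square_scalar4.
  apply: (@unimodular_lblock R 3 (4 + 4)).
  rewrite mxtrace_scalar mxtrace_block mxtrace_scalar mxtrace_Kmx.
  by lra.
split=> [d _|].
  split; last exact/exp_odd_no_lattice/odd7/exp_square_Kmx.
  apply: (@unimodular_lblock R (3 + 4) 4).
  (* The trace is [7 + 4 c] with [c = - 7 / 4]. *)
  rewrite mxtrace_Kmx mxtrace_block !mxtrace_scalar.
  by lra.
split=> [a c _ ac|].
  split; last exact/exp_odd_no_lattice/odd3/sum88/exp_square_scalar4/exp_square_scalar4.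
  apply: (@unimodular_lblock R 3 (4 + 4)).
  rewrite mxtrace_scalar mxtrace_block !mxtrace_scalar.
  by lra.
split.
  split; last exact/exp_odd_no_lattice/odd7/exp_square_scalar4.
  apply: (@unimodular_lblock R (3 + 4) 4).
  rewrite mxtrace_block !mxtrace_scalar.
  by lra.
split=> [b _|].
  split; last apply/exp_odd_no_lattice/odd3/(@exp_square_twice R 4).
  apply: (@unimodular_lblock R 3 (4 + 4)).
  (* The trace is [3 + 8 a] with [a = - 3 / 8]. *)
  rewrite mxtrace_scalar mxtrace_block !mxtrace_Kmx.
  by lra.
split; last apply/exp_odd_no_lattice/odd3/(@exp_square_twice R 4).
apply: (@unimodular_lblock R 3 (4 + 4)).
rewrite mxtrace_scalar mxtrace_block !mxtrace_scalar.
by lra.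
Qed.
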